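(* Let a set of $5$ blue points in the real plane, no three on a line, and a set of $5$ red points, disjoint from the blue points, be given, such that the line through any two blue points contains a red point. Then all $10$ points lie on a (possibly reducible) cubic curve. *)

(* Defs.v *)
From HB Require Import structures.
From mathcomp Require Import all_boot all_order all_algebra.
From mathcomp Require Import finmap.
From mathcomp Require Import mpoly.
From mathcomp Require Import reals.

Set Implicit Arguments.
Unset Strict Implicit.
Unset Printing Implicit Defensive.

Import GRing.Theory.
Local Open Scope ring_scope.

(* The real plane is 'rV[R]_2, with coordinates P 0 0 and P 0 1. *)

Record line (R : realType) := Line {
  line_a : R;
  line_b : R;
  line_c : R;
  line_nondeg : (line_a, line_b) != (0, 0) }.

Definition on_line (R : realType) (l : line R) (P : 'rV[R]_2) : bool :=
  line_a l * P 0 0 + line_b l * P 0 1 + line_c l == 0.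

Definition no_three_on_a_line (R : realType) (B : {fset 'rV[R]_2}) : Prop :=
  forall P Q S : 'rV[R]_2, P \in B -> Q \in B -> S \in B ->
  P != Q -> P != S -> Q != S ->
  ~ exists l : line R, [/\ on_line l P, on_line l Q & on_line l S].

(* The line through two distinct points is the only l satisfying both
   incidence hypotheses. *)
Definition pierces_lines_of (R : realType) (X B : {fset 'rV[R]_2}) : Prop :=
  forall P Q : 'rV[R]_2, P \in B -> Q \in B -> P != Q ->
  forall l : line R, on_line l P -> on_line l Q ->
  exists2 S, S \in X & on_line l S.

(* msize is the total degree plus one, so f has degree exactly 3; f may be
   reducible or have repeated factors. *)
Definition on_cubic_curve (R : realType) (X : {fset 'rV[R]_2}) : Prop :=
  exists2 f : {mpoly R[2]}, msize f = 4%N &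
  forall P : 'rV[R]_2, P \in X -> f.@[fun i => P 0 i] = 0.

(* Main.v *)
Require Import Defs.
From HB Require Import structures.
From mathcomp Require Import all_boot all_order all_algebra.
From mathcomp Require Import finmap.
From mathcomp Require Import mpoly.
From mathcomp Require Import reals.
From mathcomp Require Import ring zify.

(** A red point lies on at most two of the ten blue lines, since two blue lines
through it share no blue point. So the lines through the blue points color the
edges of K5 properly with five colors; such a coloring is unique up to symmetry:
the blue points can be labelled b0, ..., b4 and the red ones r0, ..., r4 so that
rk lies on bi bj whenever i + j = k modulo 5.

Write lij for the line bi bj and m for the line b3 r1. Every cubic of the pencil
spanned by l12 l04 m and l24 l03 l13 passes through all the points except
possibly r0 and r2. The member through r0 also passes through r2, because at r0
and r2 each of the six linear forms is a monomial in the determinants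
[bi bj bk], and the two monomials to be compared agree. *)

Set Implicit Arguments.
Unset Strict Implicit.
Unset Printing Implicit Defensive.

Import GRing.Theory Num.Theory.
Local Open Scope ring_scope.

(** * Brackets and intersection points of lines *)

Section Brackets.
Variable R : realType.
Implicit Types A B C P Q U V X : 'rV[R]_2.

(** The 3 by 3 determinant of the homogeneous coordinates of the three points; it vanishes exactly
    when they are collinear. *)
Definition bracket A B C : R :=
  (B 0 0 - A 0 0) * (C 0 1 - A 0 1) - (B 0 1 - A 0 1) * (C 0 0 - A 0 0).

Lemma bracketC12 A B C : bracket A B C = - bracket B A C.
Proof. by rewrite /bracket; ring. Qed.

Lemma bracketC23 A B C : bracket A B C = - bracket A C B.
Proof. by rewrite /bracket; ring. Qed.

Lemma bracket_cycle A B C : bracket A B C = bracket B C A.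
Proof. by rewrite /bracket; ring. Qed.

Lemma bracket12 A B : bracket A A B = 0.
Proof. by rewrite /bracket; ring. Qed.

Lemma bracket13 A B : bracket A B A = 0.
Proof. by rewrite /bracket; ring. Qed.

Lemma bracket23 A B : bracket A B B = 0.
Proof. by rewrite /bracket; ring. Qed.

(** In homogeneous coordinates, X times the factor on the left is [bracket P U V] times Q minus
    [bracket Q U V] times P, and bracketing with A and B is linear. No division occurs: the
    difference of the two sides is a combination of [bracket P Q X] and [bracket U V X]. *)
Lemma bracket_meet P Q U V X A B :
  bracket P Q X = 0 -> bracket U V X = 0 ->
  (bracket P U V - bracket Q U V) * bracket A B X =
  bracket P U V * bracket A B Q - bracket Q U V * bracket A B P.
Proof.
move=> PQX UVX; apply/eqP; rewrite -subr_eq0; apply/eqP.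
transitivity
  (((B 0 0 - A 0 0) * (V 0 1 - U 0 1) - (B 0 1 - A 0 1) * (V 0 0 - U 0 0))
     * bracket P Q X
   - ((B 0 0 - A 0 0) * (Q 0 1 - P 0 1) - (B 0 1 - A 0 1) * (Q 0 0 - P 0 0))
     * bracket U V X).
  by rewrite /bracket; ring.
by rewrite PQX UVX !mulr0 subrr.
Qed.

(** Expands the same intersection point over U and V, keeping the factor on the left so that both
    expansions can be combined. *)
Lemma bracket_meet_sym P Q U V X A B :
  bracket P Q X = 0 -> bracket U V X = 0 ->
  (bracket P U V - bracket Q U V) * bracket A B X =
  bracket V P Q * bracket A B U - bracket U P Q * bracket A B V.
Proof.
move=> PQX UVX; have := bracket_meet A B UVX PQX.
have -> : bracket U P Q - bracket V P Q = - (bracket P U V - bracket Q U V).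
  by rewrite /bracket; ring.
by move=> E; rewrite -[LHS]opprK -mulNr E opprB.
Qed.

(** The factor vanishes only for parallel or degenerate lines; [bracket_meet] with A = U and B = P
    would then make one of the two nonzero brackets vanish. *)
Lemma meet_neq0 P Q U V X :
  bracket P Q X = 0 -> bracket U V X = 0 ->
  bracket P U V != 0 -> bracket P Q U != 0 ->
  bracket P U V - bracket Q U V != 0.
Proof.
move=> PQX UVX nPUV nPQU; apply/eqP => w0.
have := bracket_meet U P PQX UVX.
rewrite w0 mul0r bracket23 mulr0 subr0 => /esym/eqP.
rewrite mulf_eq0 (negPf nPUV) /= bracket_cycle.
by rewrite (negPf nPQU).
Qed.

Lemma row2P A B : A 0 0 = B 0 0 -> A 0 1 = B 0 1 -> A = B.
Proof.
move=> e0 e1; apply/rowP => -[[|[|i]] lti] //.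
- by rewrite (_ : Ordinal lti = 0) //; apply: val_inj.
- by rewrite (_ : Ordinal lti = 1) //; apply: val_inj.
Qed.

(** Either coordinate of S - P, times the last bracket, is a combination of the two vanishing ones,
    and one of these coordinates is nonzero. *)
Lemma bracket_line P Q S T :
  P != S -> bracket P Q S = 0 -> bracket P T S = 0 -> bracket P Q T = 0.
Proof.
move=> nPS PQS PTS.
have H0 : (S 0 0 - P 0 0) * bracket P Q T = 0.
  transitivity ((T 0 0 - P 0 0) * bracket P Q S - (Q 0 0 - P 0 0) * bracket P T S).
    by rewrite /bracket; ring.
  by rewrite PQS PTS !mulr0 subrr.
have H1 : (S 0 1 - P 0 1) * bracket P Q T = 0.
  transitivity ((T 0 1 - P 0 1) * bracket P Q S - (Q 0 1 - P 0 1) * bracket P T S).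
    by rewrite /bracket; ring.
  by rewrite PQS PTS !mulr0 subrr.
apply/eqP; apply: contraNT nPS => n0.
move/eqP: H0; rewrite mulf_eq0 (negPf n0) orbF subr_eq0 => /eqP e0.
move/eqP: H1; rewrite mulf_eq0 (negPf n0) orbF subr_eq0 => /eqP e1.
by apply/eqP; apply: row2P.
Qed.

Lemma pentagon_identity (b0 b1 b2 b3 b4 r0 r1 r2 : 'rV[R]_2) :
  bracket b1 b4 r0 = 0 -> bracket b2 b3 r0 = 0 ->
  bracket b0 b1 r1 = 0 -> bracket b2 b4 r1 = 0 ->
  bracket b0 b2 r2 = 0 -> bracket b3 b4 r2 = 0 ->
  bracket b1 b2 b3 - bracket b4 b2 b3 != 0 ->
  bracket b0 b2 b4 - bracket b1 b2 b4 != 0 ->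
  bracket b0 b3 b4 - bracket b2 b3 b4 != 0 ->
  (bracket b2 b4 r0 * bracket b0 b3 r0 * bracket b1 b3 r0) *
  (bracket b1 b2 r2 * bracket b0 b4 r2 * bracket b3 r1 r2) =
  (bracket b1 b2 r0 * bracket b0 b4 r0 * bracket b3 r1 r0) *
  (bracket b2 b4 r2 * bracket b0 b3 r2 * bracket b1 b3 r2).
Proof.
move=> r0a r0b r1a r1b r2a r2b.
set w0 := (X in X != 0); move=> w0n.
set w1 := (X in X != 0); move=> w1n.
set w2 := (X in X != 0); move=> w2n.
(* For each bracket, the expansion chosen contains a bracket with a repeated point, so that a single
   term survives. *)
have A24 := bracket_meet b2 b4 r0a r0b.
have A03 := bracket_meet_sym b0 b3 r0a r0b.
have A13 := bracket_meet b1 b3 r0a r0b.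
have A12 := bracket_meet b1 b2 r0a r0b.
have A04 := bracket_meet b0 b4 r0a r0b.
have Am := bracket_meet_sym b3 r1 r0a r0b.
have M2 := bracket_meet_sym b2 b3 r1a r1b.
have M4 := bracket_meet_sym b4 b3 r1a r1b.
have C12 := bracket_meet b1 b2 r2a r2b.
have C04 := bracket_meet b0 b4 r2a r2b.
have C03 := bracket_meet b0 b3 r2a r2b.
have Cm := bracket_meet_sym b3 r1 r2a r2b.
have C24 := bracket_meet_sym b2 b4 r2a r2b.
have C13 := bracket_meet_sym b1 b3 r2a r2b.
rewrite -/w0 in A24 A03 A13 A12 A04 Am.
rewrite -/w1 in M2 M4.
rewrite -/w2 in C12 C04 C03 Cm C24 C13.
(* Each side has three brackets at [r0], three at [r2], and one occurrence of [r1] through the line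
   m. *)
have W : w0 ^+ 3 * w1 * w2 ^+ 3 != 0.
  by rewrite !mulf_neq0 ?expf_neq0.
apply: (mulfI W).
transitivity ((w0 * bracket b2 b4 r0) * (w0 * bracket b0 b3 r0) *
  (w0 * bracket b1 b3 r0) * (w2 * bracket b1 b2 r2) *
  (w2 * bracket b0 b4 r2) * (w1 * (w2 * bracket b3 r1 r2))); first by ring.
transitivity ((w0 * bracket b1 b2 r0) * (w0 * bracket b0 b4 r0) *
  (w1 * (w0 * bracket b3 r1 r0)) * (w2 * bracket b2 b4 r2) *
  (w2 * bracket b0 b3 r2) * (w2 * bracket b1 b3 r2)); last by ring.
have {}Am : w1 * (w0 * bracket b3 r1 r0) =
   bracket b3 b1 b4 * (w1 * bracket b2 b3 r1).
  by rewrite Am bracket13 mulr0 subr0 -(bracket_cycle b2); ring.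
have {}Cm : w1 * (w2 * bracket b3 r1 r2) =
   - bracket b3 b0 b2 * (w1 * bracket b4 b3 r1).
  by rewrite Cm bracket13 mulr0 sub0r -(bracket_cycle b4); ring.
rewrite Am Cm A24 A03 A13 A12 A04 C12 C04 C24 C03 C13 M2 M4.
rewrite !(bracket12, bracket13, bracket23) !(mulr0, sub0r, subr0).
(* Brackets of the same three points are put in a common order, after which [ring] can treat them as
   atoms. *)
rewrite -(bracket_cycle b1 b2 b4) (bracket_cycle b2 b0 b1).
rewrite (bracket_cycle b0 b1 b2) (bracketC12 b4 b0 b2) (bracket_cycle b4 b0 b1).
rewrite (bracketC23 b0 b1 b4) (bracket_cycle b4 b3 b2) (bracket_cycle b3 b2 b4).
by ring.
Qed.

(** * Construction of the cubic *)

Definition line_mpoly A B : {mpoly R[2]} :=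
  (B 0 0 - A 0 0) *: ('X_1 - (A 0 1)%:MP) - (B 0 1 - A 0 1) *: ('X_0 - (A 0 0)%:MP).

Lemma meval_line_mpoly A B X : (line_mpoly A B).@[fun i => X 0 i] = bracket A B X.
Proof. by rewrite mevalB !mevalZ !mevalB !mevalXU !mevalC. Qed.

Lemma msize_line_mpoly A B : (msize (line_mpoly A B) <= 2)%N.
Proof.
have sX (i : 'I_2) a : (msize ('X_i - a%:MP : {mpoly R[2]}) <= 2)%N.
  apply: leq_trans (mmeasureD_le _ _ _) _; rewrite mmeasureN.
  rewrite geq_max msizeX mdeg1 /= msizeC.
  by case: (_ != _).
apply: leq_trans (mmeasureD_le _ _ _) _; rewrite mmeasureN geq_max.
by rewrite !(leq_trans (msizeZ_le _ _) (sX _ _)).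
Qed.

Lemma msizeM_leq (p q : {mpoly R[2]}) : (msize (p * q) <= (msize p + msize q).-1)%N.
Proof.
have [->|p0] := eqVneq p 0; first by rewrite mul0r msize0.
have [->|q0] := eqVneq q 0; first by rewrite mulr0 msize0.
by rewrite msizeM.
Qed.

(** Degree exactly 3 is reached by multiplying with a power of ['X_0], which loses no zeros. *)
Lemma on_cubic_curve_le (X : {fset 'rV[R]_2}) (f : {mpoly R[2]}) :
  f != 0 -> (msize f <= 4)%N ->
  (forall P, P \in X -> f.@[fun i => P 0 i] = 0) -> on_cubic_curve X.
Proof.
move=> f0 sf fX; pose m : 'X_{1..2} := (U_(0%R) *+ (4 - msize f))%MM.
exists (f * 'X_[m]); last by move=> P PX; rewrite mevalM fX // mul0r.
have sX : msize ('X_[m] : {mpoly R[2]}) = (4 - msize f).+1.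
  by rewrite msizeX mdegMn mdeg1 mul1n.
rewrite msizeM // ?sX; first by rewrite addnS /= subnKC.
by rewrite -(mmeasure_poly_eq0 mdeg) sX.
Qed.

Lemma pentagon_cubic (X : {fset 'rV[R]_2}) (b r : nat -> 'rV[R]_2) :
  (forall i j k, (i < 5)%N -> (j < 5)%N -> (k < 5)%N -> uniq [:: i; j; k] ->
     bracket (b i) (b j) (b k) != 0) ->
  (forall i k, (i < 5)%N -> (k < 5)%N -> b i != r k) ->
  bracket (b 1) (b 4) (r 0) = 0 -> bracket (b 2) (b 3) (r 0) = 0 ->
  bracket (b 0) (b 1) (r 1) = 0 -> bracket (b 2) (b 4) (r 1) = 0 ->
  bracket (b 0) (b 2) (r 2) = 0 -> bracket (b 3) (b 4) (r 2) = 0 ->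
  bracket (b 0) (b 3) (r 3) = 0 -> bracket (b 1) (b 2) (r 3) = 0 ->
  bracket (b 0) (b 4) (r 4) = 0 -> bracket (b 1) (b 3) (r 4) = 0 ->
  (forall P, P \in X -> exists2 i, (i < 5)%N & P = b i \/ P = r i) ->
  on_cubic_curve X.
Proof.
move=> gen brN r0a r0b r1a r1b r2a r2b r3a r3b r4a r4b XE.
have w0 := meet_neq0 r0a r0b (gen 1 2 3 isT isT isT isT) (gen 1 4 2 isT isT isT isT).
have w1 := meet_neq0 r1a r1b (gen 0 2 4 isT isT isT isT) (gen 0 1 2 isT isT isT isT).
have w2 := meet_neq0 r2a r2b (gen 0 3 4 isT isT isT isT) (gen 0 2 3 isT isT isT isT).
have id2 := pentagon_identity r0a r0b r1a r1b r2a r2b w0 w1 w2.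
(* [c] and [d] are the values at [r 0] of l24 l03 l13 and of l12 l04 m; used crosswise as
   coefficients, they make [f] vanish at [r 0]. *)
set c := bracket (b 2) (b 4) (r 0) * _ * _ in id2.
set d := bracket (b 1) (b 2) (r 0) * _ * _ in id2.
have off i j k p : (i < 5)%N -> (j < 5)%N -> (k < 5)%N -> (p < 5)%N ->
    uniq [:: i; j; k] -> bracket (b i) (b j) (r p) = 0 ->
    bracket (b i) (b k) (r p) != 0.
  move=> li lj lk lp u ij; apply/eqP => ik.
  by have /eqP := gen i j k li lj lk u; apply; apply: bracket_line ij ik; apply: brN.
have c0 : c != 0.
  rewrite !mulf_neq0 //.
  - by rewrite bracketC12 oppr_eq0; apply: (off _ 1%N) => //; rewrite bracketC12 r0a oppr0.
  - by rewrite bracketC12 oppr_eq0; apply: (off _ 2%N) => //; rewrite bracketC12 r0b oppr0.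
  - by apply: (off _ 4%N).
pose l i j := line_mpoly (b i) (b j).
pose f : {mpoly R[2]} := c *: (l 1 2 * l 0 4 * line_mpoly (b 3) (r 1)) - d *: (l 2 4 * l 0 3 * l 1 3).
have fE P : f.@[fun i => P 0 i] =
    c * (bracket (b 1) (b 2) P * bracket (b 0) (b 4) P * bracket (b 3) (r 1) P)
  - d * (bracket (b 2) (b 4) P * bracket (b 0) (b 3) P * bracket (b 1) (b 3) P).
  by rewrite mevalB !mevalZ !mevalM !meval_line_mpoly.
apply: (@on_cubic_curve_le _ f).
(* To see that [f] is nonzero, restrict it to the line b2 b4: the second product vanishes there, and
   the first becomes a product of linear forms in [t], the last of which has the nonzero value [m2]
   at [t = 0]. *)
- have m2 : bracket (b 3) (r 1) (b 2) != 0.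
    by rewrite -(bracket_cycle (b 2)); apply: (off _ 4%N).
  have n124 := gen 1 2 4 isT isT isT isT; have n042 := gen 0 4 2 isT isT isT isT.
  pose x t : 'rV[R]_2 := b 2 + t *: (b 4 - b 2).
  have fx t : f.@[fun i => x t 0 i] = c * (t * bracket (b 1) (b 2) (b 4)
      * ((1 - t) * bracket (b 0) (b 4) (b 2))
      * ((1 - t) * bracket (b 3) (r 1) (b 2) + t * bracket (b 3) (r 1) (b 4))).
    rewrite fE (_ : bracket (b 2) (b 4) (x t) = 0); last first.
      by rewrite /bracket !mxE; ring.
    rewrite !mul0r mulr0 subr0; congr (_ * (_ * _ * _)).
    - by rewrite /bracket !mxE; ring.
    - by rewrite /bracket !mxE; ring.
    - by rewrite /bracket !mxE; ring.
  apply/eqP => f0.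
  have fx0 t : t != 0 -> 1 - t != 0 ->
      (1 - t) * bracket (b 3) (r 1) (b 2) + t * bracket (b 3) (r 1) (b 4) = 0.
    move=> t0 t1; apply/eqP; apply: contraT => mt.
    suff: f.@[fun i => x t 0 i] != 0 by rewrite f0 meval0 eqxx.
    by rewrite fx; apply: (mulf_neq0 c0); rewrite !mulf_neq0.
  (* A linear form vanishing at both [t = -1] and [t = 2] is zero. *)
  have e1 : (1 - (-1) : R) != 0 by rewrite (_ : 1 - -1 = 2 :> R) ?pnatr_eq0 //; ring.
  have e2 : (1 - 2 : R) != 0 by rewrite (_ : 1 - 2 = -1 :> R) ?oppr_eq0 ?oner_eq0 //; ring.
  have h1 := fx0 (-1); rewrite oppr_eq0 oner_eq0 in h1; have {}h1 := h1 isT e1.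
  have h2 := fx0 2; rewrite pnatr_eq0 in h2; have {}h2 := h2 isT e2.
  have : 3 * bracket (b 3) (r 1) (b 2) = 0.
    set A := bracket _ _ (b 2) in h1 h2 *; set B := bracket _ _ (b 4) in h1 h2.
    transitivity (2 * ((1 - -1) * A + -1 * B) + ((1 - 2) * A + 2 * B)); first by ring.
    by rewrite h1 h2 mulr0 addr0.
  by move/eqP; rewrite mulf_eq0 pnatr_eq0 (negPf m2).
- have s3 A B C D E F : (msize (line_mpoly A B * line_mpoly C D * line_mpoly E F) <= 4)%N.
    apply: leq_trans (msizeM_leq _ _) _.
    have := msizeM_leq (line_mpoly A B) (line_mpoly C D).
    have := msize_line_mpoly A B; have := msize_line_mpoly C D.
    have := msize_line_mpoly E F; lia.
  apply: leq_trans (mmeasureD_le _ _ _) _; rewrite mmeasureN geq_max.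
  by rewrite !(leq_trans (msizeZ_le _ _) (s3 _ _ _ _ _ _)).
(* Each blue point lies on a line of either product. *)
- move=> P /XE[i li [] ->]; rewrite fE.
    case: i li => [|[|[|[|[|//]]]]] _;
    by rewrite !(bracket12, bracket13, bracket23) !(mul0r, mulr0) subrr.
  case: i li => [|[|[|[|[|//]]]]] _.
  + by rewrite -/c -/d; apply/eqP; rewrite subr_eq0 mulrC.
  + by rewrite r1b bracket23 !(mul0r, mulr0) subrr.
  + by rewrite id2 subrr.
  + by rewrite r3a r3b !(mul0r, mulr0) subrr.
  + by rewrite r4a r4b !(mul0r, mulr0) subrr.
Qed.

End Brackets.

(** * Proper edge colorings of K5 with five colors *)

Section PentagonLabelling.
Local Open Scope nat_scope.

Definition K5_edges : seq (nat * nat) :=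
  [:: (0, 1); (0, 2); (0, 3); (0, 4); (1, 2); (1, 3); (1, 4); (2, 3); (2, 4); (3, 4)].

Definition adjacent (e f : nat * nat) :=
  [|| e.1 == f.1, e.1 == f.2, e.2 == f.1 | e.2 == f.2].

(** A coloring is coded as the list of its colors along [K5_edges], where the smaller endpoint comes
    first. *)
Definition color_of (cs : seq nat) i j :=
  nth 0 cs (index (minn i j, maxn i j) K5_edges).

(* Under the labelling [s], the edges ij and kl with i + j = k + l modulo 5
   have the same color, and these five colors are 0, ..., 4. *)
Definition pentagonal (c : nat -> nat -> nat) (s : seq nat) :=
  let d i j := c (nth 0 s i) (nth 0 s j) in
  [&& d 1 4 == d 2 3, d 0 1 == d 2 4, d 0 2 == d 3 4, d 0 3 == d 1 2,
      d 0 4 == d 1 3 &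
      all (mem [:: d 1 4; d 0 1; d 0 2; d 0 3; d 0 4]) (iota 0 5)].

(** The next edge to be colored is the one at position [size cs]. *)
Definition compatible cs x :=
  all (fun k => if adjacent (nth (0, 0) K5_edges k) (nth (0, 0) K5_edges (size cs))
                then nth 0 cs k != x else true) (iota 0 (size cs)).

(* Backtracking over the proper 5-colorings of K5 that extend [cs] by [n] edges;
   [if] is used instead of [==>] so that evaluation prunes. *)
Fixpoint all_pentagonal n cs :=
  if n is n'.+1 then
    all (fun x => if compatible cs x then all_pentagonal n' (rcons cs x) else true)
        (iota 0 5)
  else has (pentagonal (color_of cs)) (permutations (iota 0 5)).

(** No step of the branch [ds] of the search is pruned, so a successful search has checked its
    leaf. *)
Lemma all_pentagonalP n cs ds :
  all_pentagonal n cs -> size ds = n -> all (gtn 5) ds ->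
  (forall k, k < n -> compatible (cs ++ take k ds) (nth 0 ds k)) ->
  all_pentagonal 0 (cs ++ ds).
Proof.
elim: n cs ds => [|n IH] cs [|x ds] //.
  by rewrite cats0.
move=> /allP search [sz] /andP[x5 ds5] comp; rewrite -cat_rcons.
apply: IH => //.
  have := search x; rewrite mem_iota /= => /(_ x5).
  by have := comp 0 isT; rewrite take0 cats0 /= => ->.
by move=> k lk; have := comp k.+1 lk; rewrite /= -cat_rcons.
Qed.

Lemma all_K5_colorings_pentagonal : all_pentagonal 10 [::].
Proof. by vm_compute. Qed.

Lemma nth_perm_iota_lt n s i : perm_eq s (iota 0 n) -> i < n -> nth 0 s i < n.
Proof.
move=> sn lt_in; have : nth 0 s i \in iota 0 n.
  by rewrite -(perm_mem sn) mem_nth // (perm_size sn) size_iota.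
by rewrite mem_iota.
Qed.

Lemma nth_perm_iota_eq n s i j : perm_eq s (iota 0 n) -> i < n -> j < n ->
  (nth 0 s i == nth 0 s j) = (i == j).
Proof.
move=> sn lt_in lt_jn.
by rewrite nth_uniq ?(perm_size sn) ?size_iota // (perm_uniq sn) iota_uniq.
Qed.

(** Listed along [K5_edges], the colors given by [c] form a leaf of the exhaustive search. *)
Lemma exists_pentagonal_labelling (c : nat -> nat -> nat) :
  (forall i j, c i j = c j i) ->
  (forall i j, i < 5 -> j < 5 -> i != j -> c i j < 5) ->
  (forall i j k, i < 5 -> j < 5 -> k < 5 -> uniq [:: i; j; k] -> c i j != c i k) ->
  exists2 s, perm_eq s (iota 0 5) & pentagonal c s.
Proof.
move=> csym c5 cproper.
pose ds := [seq c e.1 e.2 | e <- K5_edges].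
have edgeP e : e \in K5_edges -> [&& e.1 < 5, e.2 < 5 & e.1 < e.2].
  by move: e; apply/allP.
have adjP e f : e \in K5_edges -> f \in K5_edges -> e != f -> adjacent e f ->
    c e.1 e.2 != c f.1 f.2.
  case: e f => [i j] [k l] /edgeP/and3P[/= i5 j5 ij] /edgeP/and3P[/= k5 l5 kl] ne.
  rewrite /adjacent /= => /or4P[] /eqP E; subst.
  - apply: cproper => //=; rewrite !inE !negb_or andbT.
    by move: ne; rewrite xpair_eqE eqxx /=; lia.
  - by rewrite [c k _]csym; apply: cproper => //=; rewrite !inE; lia.
  - by rewrite [c i _]csym; apply: cproper => //=; rewrite !inE; lia.
  - rewrite [c i _]csym [c k _]csym; apply: cproper => //=; rewrite !inE !negb_or andbT.
    by move: ne; rewrite xpair_eqE eqxx andbT; lia.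
have : all_pentagonal 0 ([::] ++ ds).
  apply: all_pentagonalP all_K5_colorings_pentagonal _ _ _ => //.
    rewrite all_map; apply/allP => e /edgeP/and3P[i5 j5 ij] /=.
    by apply: c5 => //; rewrite neq_ltn ij.
  move=> k k10; rewrite cat0s /compatible size_take k10; apply/allP => j.
  rewrite mem_iota /= add0n => jk; case: ifP => // adj.
  have j10 := ltn_trans jk k10.
  rewrite nth_take // !(nth_map (0, 0)) //; apply: adjP adj; rewrite ?mem_nth //.
  by rewrite nth_uniq // ltn_eqF.
move=> /hasP[s]; rewrite mem_permutations => sperm pent; exists s => //.
have s5 i : i < 5 -> nth 0 s i < 5 by apply: nth_perm_iota_lt.
have su i j : i < 5 -> j < 5 -> (nth 0 s i == nth 0 s j) = (i == j).
  exact: nth_perm_iota_eq.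
have colE i j : i < 5 -> j < 5 -> i != j -> color_of ds i j = c i j.
  by case: i => [|[|[|[|[|//]]]]]; case: j => [|[|[|[|[|//]]]]].
have dE i j : i < 5 -> j < 5 -> i != j ->
    color_of ds (nth 0 s i) (nth 0 s j) = c (nth 0 s i) (nth 0 s j).
  by move=> i5 j5 ij; rewrite colE ?s5 ?su.
by move: pent; rewrite /pentagonal !dE.
Qed.

End PentagonLabelling.

(** * From the incidence hypotheses to the labelled pentagon *)

Lemma line_through (R : realType) (P Q : 'rV[R]_2) :
  P != Q -> exists l : line R, forall X, on_line l X = (bracket P Q X == 0).
Proof.
move=> nPQ.
have nd : (P 0 1 - Q 0 1, Q 0 0 - P 0 0) != (0, 0).
  apply: contra nPQ; rewrite xpair_eqE !subr_eq0 => /andP[/eqP e1 /eqP e0].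
  by apply/eqP; apply: row2P.
exists (Line ((Q 0 1 - P 0 1) * P 0 0 - (Q 0 0 - P 0 0) * P 0 1) nd) => X.
by rewrite /on_line /bracket /=; congr (_ == 0); ring.
Qed.

Lemma bracket_neq0 (R : realType) (B : {fset 'rV[R]_2}) P Q S :
  no_three_on_a_line B -> P \in B -> Q \in B -> S \in B ->
  P != Q -> P != S -> Q != S -> bracket P Q S != 0.
Proof.
move=> gen PB QB SB PQ PS QS; apply/eqP => PQS.
have [l lE] := line_through PQ.
by apply: (gen P Q S) => //; exists l; rewrite !lE bracket13 bracket23 PQS eqxx.
Qed.

Local Open Scope fset_scope.

Theorem theorem2p13 (R : realType) (blue red : {fset 'rV[R]_2})
  (blue5 : #|` blue| = 5%N) (red5 : #|` red| = 5%N)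
  (blue_gen : no_three_on_a_line blue)
  (red_blue : [disjoint red & blue])
  (red_lines : pierces_lines_of red blue) :
  on_cubic_curve (blue `|` red).
Proof.
pose b i : 'rV[R]_2 := nth 0 (enum_fset blue) i.
pose r k : 'rV[R]_2 := nth 0 (enum_fset red) k.
(* The color of the edge ij is the position of the first red point on its line; [find] would return
   5 if there were none, which [c_has] excludes. *)
pose c i j := find (fun S => bracket (b i) (b j) S == 0) (enum_fset red).
have bB i : (i < 5)%N -> b i \in blue by rewrite -blue5; apply: mem_nth.
have rR k : (k < 5)%N -> r k \in red by rewrite -red5; apply: mem_nth.
have bN i j : (i < 5)%N -> (j < 5)%N -> i != j -> b i != b j.
  by move=> i5 j5; rewrite /b nth_uniq ?fset_uniq ?blue5.
have brN i k : (i < 5)%N -> (k < 5)%N -> b i != r k.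
  move=> i5 k5; apply: contraTneq (rR k k5) => <-.
  by apply/negP => bR; have /fdisjointP/(_ _ bR) := red_blue; rewrite bB.
have b_gen i j k : (i < 5)%N -> (j < 5)%N -> (k < 5)%N -> uniq [:: i; j; k] ->
    bracket (b i) (b j) (b k) != 0.
  move=> i5 j5 k5 /=; rewrite !inE !negb_or andbT => /andP[/andP[ij ik] jk].
  by apply: (bracket_neq0 blue_gen); rewrite ?bB ?bN.
have c_has i j : (i < 5)%N -> (j < 5)%N -> i != j ->
    has (fun S => bracket (b i) (b j) S == 0) (enum_fset red).
  move=> i5 j5 ij; have [l lE] := line_through (bN i j i5 j5 ij).
  have [||S SR] := red_lines _ _ (bB i i5) (bB j j5) (bN i j i5 j5 ij) l.
  - by rewrite lE bracket13.
  - by rewrite lE bracket23.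
  - by rewrite lE => S0; apply/hasP; exists S.
have cE i j : (i < 5)%N -> (j < 5)%N -> i != j ->
    bracket (b i) (b j) (r (c i j)) = 0.
  by move=> i5 j5 ij; apply/eqP; apply: (nth_find 0 (c_has i j i5 j5 ij)).
have c5 i j : (i < 5)%N -> (j < 5)%N -> i != j -> (c i j < 5)%N.
  by move=> i5 j5 ij; have := c_has i j i5 j5 ij; rewrite has_find red5.
have [||s sperm] := @exists_pentagonal_labelling c _ c5.
- by move=> i j; apply: eq_find => S; rewrite bracketC12 oppr_eq0.
- move=> i j k i5 j5 k5 u; move: (u); rewrite /= !inE !negb_or andbT => /andP[/andP[ij ik] jk].
  (* A red point common to the lines ij and ik differs from [b i], so it would make the three blue
     points collinear. *)
  apply/eqP => e; have /eqP := b_gen i j k i5 j5 k5 u; apply.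
  apply: (@bracket_line _ _ _ (r (c i j))); rewrite ?brN ?c5 ?cE // e cE //.
have s5 i : (i < 5)%N -> (nth 0%N s i < 5)%N by apply: nth_perm_iota_lt.
have su i j : (i < 5)%N -> (j < 5)%N -> (nth 0%N s i == nth 0%N s j) = (i == j).
  exact: nth_perm_iota_eq.
pose sb i := b (nth 0%N s i).
have sbE i j : (i < 5)%N -> (j < 5)%N -> i != j ->
    bracket (sb i) (sb j) (r (c (nth 0%N s i) (nth 0%N s j))) = 0.
  by move=> i5 j5 ij; rewrite cE ?s5 ?su.
rewrite /pentagonal => /and5P[/eqP e0 /eqP e1 /eqP e2 /eqP e3 /andP[/eqP e4 /allP cover]].
(* Entry k is the position of the red point on the lines ij with i + j = k modulo 5 in the new
   labelling. *)
pose d := [:: c (nth 0%N s 1) (nth 0%N s 4); c (nth 0%N s 0) (nth 0%N s 1);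
  c (nth 0%N s 0) (nth 0%N s 2); c (nth 0%N s 0) (nth 0%N s 3);
  c (nth 0%N s 0) (nth 0%N s 4)].
have d5 k : (k < 5)%N -> (nth 0%N d k < 5)%N.
  by case: k => [|[|[|[|[|//]]]]] _; apply: c5; rewrite ?s5 ?su.
apply: (@pentagon_cubic _ _ sb (fun k => r (nth 0%N d k))).
- by move=> i j k i5 j5 k5 u; apply: b_gen; rewrite ?s5 //; move: u; rewrite /= !inE !su.
- by move=> i k i5 k5; rewrite brN ?s5 ?d5.
- exact: sbE.
- by rewrite /= e0; apply: sbE.
- exact: sbE.
- by rewrite /= e1; apply: sbE.
- exact: sbE.
- by rewrite /= e2; apply: sbE.
- exact: sbE.
- by rewrite /= e3; apply: sbE.
- exact: sbE.
- by rewrite /= e4; apply: sbE.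
move=> P; rewrite inE => /orP[] PX.
  have i5 : (index P (enum_fset blue) < 5)%N by rewrite -blue5 index_mem.
  have is_ : index P (enum_fset blue) \in s by rewrite (perm_mem sperm) mem_iota.
  exists (index (index P (enum_fset blue)) s).
    by rewrite -(size_iota 0 5) -(perm_size sperm) index_mem.
  by left; rewrite /sb /b !nth_index.
have k5 : (index P (enum_fset red) < 5)%N by rewrite -red5 index_mem.
(* All five colors occur in [d], so every red point receives a label. *)
have kd : index P (enum_fset red) \in d by apply: cover; rewrite mem_iota.
exists (index (index P (enum_fset red)) d); first by rewrite index_mem.
by right; rewrite /r !nth_index.
Qed.
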